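(* Let $G$ be a treeable group of finite cost. Let $w\in G$, and let $H\le G$ be a subgroup of finite index. Let $\{g_1,\ldots,g_k\}$ be a set of representatives of the double cosets in $\langle w\rangle\backslash G/H$, let $\{w_1,\ldots,w_k\}$ be the corresponding complete lift of $w$ to $H$, and let $K=\langle w_1,\ldots,w_k\rangle\le H$ be the subgroup it generates. Assume that \begin{enumerate} \item $K$ is free of rank $k$, i.e. $w_1,\ldots,w_k$ is a free basis of $K$; \item $K$ is a measure free factor of $H$. \end{enumerate} Then $\langle w\rangle$ is a measure free factor of $G$.
   Context: Groups are countable (discrete). Lifts: let $H\le G$ have finite index and $w\in G$. For $g\in G$, $m(g)$ is the minimum positive integer $t$ such that $g^{-1}w^tg\in H$. Given a set $\{g_1,\ldots,g_k\}$ of representatives of the double cosets in $\langle w\rangle\backslash G/H$, the corresponding complete lift of $w$ to $H$ is $\{w_1,\ldots,w_k\}$ with $w_i=g_i^{-1}w^{m(g_i)}g_i\in H$. Actions and orbit relations: a Borel action $G\curvearrowright X$ on a standard Borel probability space $(X,\mu)$ is p.m.p. if $G$ acts by $\mu$-preserving Borel automorphisms, and it is free if the set of $x\in X$ with $g\cdot x=x$ for some non-trivial $g\in G$ has measure zero. For $H\le G$, $E_H^X$ is the equivalence relation on $X$ whose classes are the $H$-orbits. A Borel equivalence relation on $X$ is one that is a Borel subset of $X\times X$. Graphings, treeings, cost: a graphing for a Borel equivalence relation $E$ on $X$ is a countable family $\Phi=\{\varphi_i:A_i\to B_i\}_{i\in I}$ of Borel isomorphisms between Borel subsets of $X$ such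 that $E$ is the smallest Borel equivalence relation containing all pairs $(x,\varphi_i(x))$, $i\in I$, $x\in A_i$. $E$ is measure preserving (m.p.) if it has a graphing all of whose maps preserve $\mu$ (then every graphing does). A graphing defines a graph on $X$ with an edge joining $x$ to $\varphi_i(x)$ for each $i\in I$, $x\in A_i$ (loops and multiple edges count as cycles), whose connected components are the classes of $E$. A graphing of an m.p. relation $E$ is a treeing if this graph is a tree on almost every class; $E$ is treeable if it admits a treeing. The cost of a graphing is $C(\Phi)=\sum_i\mu(A_i)$, and the cost $C(E)$ of an m.p. Borel equivalence relation is the infimum of the costs of its graphings. A group $G$ is treeable if there is a free p.m.p. Borel action $G\curvearrowright X$ on a standard Borel probability space with $E_G^X$ treeable. The cost of a group $G$ is the infimum of $C(E_G^X)$ over all free p.m.p. Borel actions of $G$ on standard Borel probability spaces. Free products: Borel equivalence relations $E_1,E_2$ are orthogonal, $E_1\perp E_2$, if for every $n\ge1$ and every cycle $(x_i)_{i\in\mathbb{Z}_{2n}}$ of points with $(x_i,x_{i+1})\in E_1$ for all odd $i$ and $(x_i,x_{i+1})\in E_2$ for all even $i$, one has $x_i=x_{i+1}$ for some $i$. An m.p. Borel equivalence relation $E$ is the free product $E=E_1*E_2$ of Borel sub-equivalence relations if $E$ is generated by $E_1\cup E_2$ and there is a full measure set $B$ with $E_1|_B\perp E_2|_B$, where $E_i|_B=E_i\cap(B\times B)$. A subgroup $H\le G$ is a measure free factor of $G$ if there exist a free p.m.p. Borel action $G\curvearrowright X$ on a standard Borel probability space and a Borel equivalence relation $E'$ on $X$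 such that $E_G^X=E_H^X*E'$. *)

(* Defs.v *)
From HB Require Import structures.
From Stdlib Require Import Relation_Operators.
From mathcomp Require Import all_boot all_order all_algebra.
From mathcomp Require Import all_classical all_reals all_analysis.
Set Implicit Arguments.
Unset Strict Implicit.
Unset Printing Implicit Defensive.
Import Order.TTheory GRing.Theory Num.Theory.
Local Open Scope classical_set_scope.
Local Open Scope ring_scope.

Section Groups.
Variable G : groupType.
Implicit Types (A B H K : set G).

Definition subgroup H : Prop := group_closed (mem H).

Definition generated_subgroup A : set G := smallest subgroup A.

Definition finite_index H : Prop :=
  finite_set (range (fun x : G => [set (x * h)%g | h in H])).

Definition double_coset A (x : G) B : set G :=
  [set (a * x * b)%g | a in A & b in B].

Definition double_cosets A B : set (set G) :=
  range (fun x : G => double_coset A x B).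

Definition double_coset_representatives A B k (g : 'I_k -> G) : Prop :=
  set_bij [set: 'I_k] (double_cosets A B) (fun i => double_coset A (g i) B).

Definition lift_exponent (w : G) H (g : G) (m : nat) : Prop :=
  let P (t : nat) := (0 < t)%N /\ H (g^-1 * w ^+ t * g)%g in
  P m /\ forall t : nat, P t -> (m <= t)%N.

Definition complete_lift (w : G) H k (g v : 'I_k -> G) : Prop :=
  forall i, exists2 m : nat,
    lift_exponent w H (g i) m & v i = ((g i)^-1 * w ^+ m * g i)%g.

(* The letter (i, true) stands for the i-th generator and (i, false) for its
   inverse. *)
Definition reduced_word k (s : seq ('I_k * bool)) : Prop :=
  sorted (fun a b => b != (a.1, ~~ a.2)) s.

Definition eval_word k (v : 'I_k -> G) (s : seq ('I_k * bool)) : G :=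
  (\prod_(a <- s) (if a.2 then v a.1 else (v a.1)^-1))%g.

(* Evaluation identifies the free group on k letters, as the set of reduced
   words, with K. *)
Definition free_basis k (v : 'I_k -> G) K : Prop :=
  set_bij [set s | reduced_word s] K (eval_word v).

End Groups.

(* X is Borel isomorphic to a Polish space T. *)
Definition standard_borel (R : realType) d (X : measurableType d) : Prop :=
  exists (T : completePseudoMetricType R) (f : X -> T),
    [/\ hausdorff_space T, @second_countable T, bijective f &
        forall A : set X, measurable A <-> <<s @open T >> (f @` A)].

Section Relations.
Context {R : realType} d (X : measurableType d) (mu : probability X R).
Implicit Types (E F : set (X * X)) (A B C : set X).

Definition equivalence_relation E : Prop :=
  [/\ forall x, E (x, x),
      forall x y, E (x, y) -> E (y, x) &
      forall x y z, E (x, y) -> E (y, z) -> E (x, z)].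

Definition borel_equivalence E : Prop :=
  measurable E /\ equivalence_relation E.

(* The intersection [smallest] need not be Borel, hence the first clause. *)
Definition borel_generated_by E (S : set (X * X)) : Prop :=
  borel_equivalence E /\ E = smallest borel_equivalence S.

Definition class_of E (x : X) : set X := [set y | E (x, y)].

(* The values of [pfun] outside [pdom] are irrelevant. *)
Record partial_map := PartialMap { pdom : set X ; pfun : X -> X }.

(* A Borel isomorphism from pdom phi onto its image; the image is Borel by the
   last clause. *)
Definition partial_borel_iso (phi : partial_map) : Prop :=
  [/\ measurable (pdom phi),
      set_inj (pdom phi) (pfun phi),
      measurable_fun (pdom phi) (pfun phi) &
      forall C, measurable C -> C `<=` pdom phi -> measurable (pfun phi @` C)].

Definition measure_preserving (phi : partial_map) : Prop :=
  forall C, measurable C -> C `<=` pdom phi -> mu (pfun phi @` C) = mu C.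

Definition graph_pairs (I : countType) (Phi : I -> partial_map) : set (X * X) :=
  [set p | exists2 i, pdom (Phi i) p.1 & p.2 = pfun (Phi i) p.1].

Definition graphing E (I : countType) (Phi : I -> partial_map) : Prop :=
  (forall i, partial_borel_iso (Phi i)) /\
  borel_generated_by E (graph_pairs Phi).

Definition mp_relation E : Prop :=
  borel_equivalence E /\
  exists (I : countType) (Phi : I -> partial_map),
    graphing E Phi /\ forall i, measure_preserving (Phi i).

(* The edges of the multigraph of Phi are the pairs (i, x) with x in
   pdom (Phi i); such an edge has end points x and pfun (Phi i) x. *)
Definition joins (I : countType) (Phi : I -> partial_map) (e : I * X)
    (u v : X) : Prop :=
  let x := e.2 in let y := pfun (Phi e.1) x in
  pdom (Phi e.1) x /\ ((u = x /\ v = y) \/ (u = y /\ v = x)).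

(* Distinct vertices and distinct edges, so that n = 1 is a loop and n = 2 a
   double edge. *)
Definition graph_cycle (I : countType) (Phi : I -> partial_map) n
    (v : 'I_n -> X) (e : 'I_n -> I * X) : Prop :=
  [/\ (0 < n)%N, injective v, injective e &
      forall j, joins Phi (e j) (v j) (v (ordS j))].

Definition connected_on (I : countType) (Phi : I -> partial_map) C : Prop :=
  forall x y, C x -> C y ->
    clos_refl_trans X
      (fun u v => [/\ C u, C v & exists e, joins Phi e u v]) x y.

Definition acyclic_on (I : countType) (Phi : I -> partial_map) C : Prop :=
  forall n (v : 'I_n -> X) (e : 'I_n -> I * X),
    (forall j, C (v j)) -> ~ graph_cycle Phi v e.

Definition tree_on (I : countType) (Phi : I -> partial_map) C : Prop :=
  connected_on Phi C /\ acyclic_on Phi C.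

Definition treeing E (I : countType) (Phi : I -> partial_map) : Prop :=
  graphing E Phi /\ {ae mu, forall x, tree_on Phi (class_of E x)}.

Definition treeable_relation E : Prop :=
  mp_relation E /\
  exists (I : countType) (Phi : I -> partial_map), treeing E Phi.

Definition graphing_cost (I : countType) (Phi : I -> partial_map) : \bar R :=
  \esum_(i in [set: I]) mu (pdom (Phi i)).

Definition relation_cost E : \bar R :=
  ereal_inf [set c | exists (I : countType) (Phi : I -> partial_map),
    graphing E Phi /\ c = graphing_cost Phi].

Definition orthogonal_relations E F : Prop :=
  forall n (x : 'I_(n.*2) -> X), (0 < n)%N ->
    (forall i : 'I_(n.*2), odd i -> E (x i, x (ordS i))) ->
    (forall i : 'I_(n.*2), ~~ odd i -> F (x i, x (ordS i))) ->
    exists i, x i = x (ordS i).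

Definition restrict_relation E B : set (X * X) := E `&` (B `*` B).

Definition free_product E E1 E2 : Prop :=
  [/\ mp_relation E,
      borel_equivalence E1 /\ E1 `<=` E,
      borel_equivalence E2 /\ E2 `<=` E,
      borel_generated_by E (E1 `|` E2) &
      exists B, [/\ measurable B, mu B = 1%E &
        orthogonal_relations (restrict_relation E1 B)
                             (restrict_relation E2 B)]].

End Relations.

(* Groups are presented as subgroups H of an ambient group G (the group G itself
   being [set: G]).  An action of H is a map G -> X -> X whose values outside H
   are irrelevant. *)
Section Actions.
Variables (R : realType) (G : groupType).
Implicit Types (H K : set G).

Definition is_action (X : Type) H (a : G -> X -> X) : Prop :=
  (forall x, a 1%g x = x) /\
  (forall g h, H g -> H h -> forall x, a (g * h)%g x = a g (a h x)).

Definition pmp_action H d (X : measurableType d) (mu : probability X R)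
    (a : G -> X -> X) : Prop :=
  [/\ is_action H a,
      forall g, H g -> measurable_fun setT (a g) &
      forall g, H g -> forall A, measurable A -> mu (a g @^-1` A) = mu A].

Definition free_action H d (X : measurableType d) (mu : probability X R)
    (a : G -> X -> X) : Prop :=
  mu.-negligible [set x | exists g, [/\ H g, g <> 1%g & a g x = x]].

Definition free_pmp_action H d (X : measurableType d) (mu : probability X R)
    (a : G -> X -> X) : Prop :=
  [/\ standard_borel R X, pmp_action H mu a & free_action H mu a].

Definition orbit_relation H (X : Type) (a : G -> X -> X) : set (X * X) :=
  [set p | exists2 h, H h & a h p.1 = p.2].

Definition treeable_group H : Prop :=
  exists d (X : measurableType d) (mu : probability X R) (a : G -> X -> X),
    free_pmp_action H mu a /\ treeable_relation mu (orbit_relation H a).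

Definition group_cost H : \bar R :=
  ereal_inf [set c |
    exists d (X : measurableType d) (mu : probability X R) (a : G -> X -> X),
      free_pmp_action H mu a /\ c = relation_cost mu (orbit_relation H a)].

Definition measure_free_factor H K : Prop :=
  [/\ subgroup H, subgroup K, K `<=` H &
    exists d (X : measurableType d) (mu : probability X R) (a : G -> X -> X)
        (E' : set (X * X)),
      [/\ free_pmp_action H mu a, borel_equivalence E' &
          free_product mu (orbit_relation H a) (orbit_relation K a) E']].

End Actions.

(* Main.v *)
Require Import Defs.
From HB Require Import structures.
From mathcomp Require Import all_boot all_order all_algebra.
From mathcomp Require Import all_classical all_reals all_analysis.
Set Implicit Arguments.
Unset Strict Implicit.
Unset Printing Implicit Defensive.
Import Order.TTheory GRing.Theory Num.Theory.
Local Open Scope classical_set_scope.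
Local Open Scope ring_scope.

(** Let [n.+1] be the index of [H] in [G], and let [H] act on [X] as in the
    hypothesis on [K], with [E_H = E_K * E'].  The required action of [G] is the
    one induced from this action of [H]: it lives on [X * 'I_n.+1], one copy of
    [X] for each left coset of [H], and [g] sends [(x, c)] to [(a h x, e)] when
    [g * r c = r e * h], where [r] is a left transversal of [H].  It is free and
    preserves the normalised sum of the copies of [mu]
    ([induced_free_pmp_action]).

    The transversal is chosen to contain the representatives [g i] of the double
    cosets ([left_transversal_extending]); call the copy of [X] with index
    [b i], where [r (b i) = g i], the [i]-th base copy.  Every orbit of [w] on
    the cosets contains exactly one base copy, and the return maps of powers of
    [w] to the [i]-th base copy are the powers of [v i].  So [w] acts like
    [v i], spread over an orbit of copies, whereas the [v i] freely generate
    [K].  The complement of [E_<w>] is the relation [spread_relation]: it is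
    generated by [E'] on the base copies and by the identifications of the base
    copies with one another.

    Generation: inside one base copy, the two relations yield [E'] and every
    [v i], hence all of [E_H]; every other copy is reached from a base copy by a
    power of [w].

    Freeness: in a cycle alternating between the two relations without
    degenerate edges, all vertices lie in base copies.  An edge in [E_<w>] moves
    a point by a non-trivial power of some [v i] within the [i]-th base copy,
    and an edge in the complement either is a non-degenerate [E']-edge or fixes
    the point of [X] and changes the base copy.  Between two consecutive
    non-degenerate [E']-edges, the powers of the [v i] therefore multiply to a
    non-empty reduced word, which has no fixed point as [K] is free on the
    [v i] and acts freely.  Forgetting the copies leaves a cycle alternating
    between [E_K] and [E'], contradicting their orthogonality
    ([no_block_cycle]). *)

(** * Alternating cycles as cyclic lists of edges *)

Section AlternatingCycles.
Context d (X : measurableType d).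
Implicit Types (E F : set (X * X)) (s : seq (X * X)).

(** [proper_link F a b] says that the edge [b] starts where a non-degenerate
    [F]-edge issuing from the end of the edge [a] arrives. *)
Definition proper_link F : rel (X * X) :=
  fun a b => `[< F (a.2, b.1) /\ a.2 <> b.1 >].

(** The cycle [x_0, ..., x_(2n-1)] corresponds to the list of its [E]-edges
    [(x_(2j+1), x_(2j+2))], the indices being read modulo [2n]. *)
Lemma orthogonal_no_cycle E F s :
  orthogonal_relations E F ->
  {in s, forall a, E a /\ a.1 <> a.2} ->
  cycle (proper_link F) s -> s = [::].
Proof.
move=> EF; case: s => [//|p0 s0]; set s := p0 :: s0 => sE sF.
have s_gt0 : (0 < size s)%N by [].
have {}sF j : (j < size s)%N ->
    proper_link F (nth p0 (last p0 s :: s) j) (nth p0 s j).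
  by move: sF; rewrite (cycle_path p0) => /(pathP p0); apply.
pose x (i : 'I_((size s).*2)) : X :=
  if odd i then (nth p0 s i./2).1 else (nth p0 (last p0 s :: s) i./2).2.
have half_lt (i : 'I_((size s).*2)) : (i./2 < size s)%N.
  by rewrite ltn_half_double.
have x_odd (i : 'I_((size s).*2)) : odd i -> (x i, x (ordS i)) = nth p0 s i./2.
  move=> oi; rewrite [RHS]surjective_pairing {1}/x oi; congr pair.
  have iE : i = i./2.*2.+1 :> nat by rewrite -[LHS]odd_double_half oi.
  have [lt_i|ge_i] := ltnP i.+1 (size s).*2.
    by rewrite /x /= modn_small //= oi /= uphalf_half oi.
  have iS : i.+1 = (size s).*2 by apply/eqP; rewrite eqn_leq ge_i ltn_ord.
  have -> : i./2 = (size s).-1.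
    by have := congr1 half iS; rewrite doubleK /= uphalf_half oi => -[].
  by rewrite nth_last /x /= iS modnn.
have x_even (i : 'I_((size s).*2)) : ~~ odd i ->
    F (x i, x (ordS i)) /\ x i <> x (ordS i).
  move=> ei; have iE : i = i./2.*2 :> nat.
    by rewrite -[LHS]odd_double_half (negbTE ei).
  have lt_i : (i.+1 < (size s).*2)%N.
    by rewrite iE -doubleS ltn_Sdouble half_lt.
  have /asboolP := sF _ (half_lt i).
  by rewrite /x (negbTE ei) /= modn_small //= ei -/s uphalf_half (negbTE ei).
have x_oddE (i : 'I_((size s).*2)) : odd i -> E (x i, x (ordS i)).
  by move=> oi; rewrite x_odd //; exact: (sE _ (mem_nth p0 (half_lt i))).1.
have [i xi] := EF _ x s_gt0 x_oddE (fun i ei => (x_even i ei).1).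
have [oi|/x_even[_]//] := boolP (odd i).
by have := (sE _ (mem_nth p0 (half_lt i))).2; rewrite -(x_odd i oi).
Qed.

Lemma no_cycle_orthogonal E F :
  (forall s, {in s, forall a, E a /\ a.1 <> a.2} ->
     cycle (proper_link F) s -> s = [::]) ->
  orthogonal_relations E F.
Proof.
move=> EF [//|n] x _ xE xF; apply: contrapT => /forallNP x_neq.
pose o j : 'I_(n.+1.*2) := inord j.*2.+1.
have oE j : (j < n.+1)%N -> o j = j.*2.+1 :> nat.
  by move=> jn; rewrite inordK // ltnS ltnS leq_double.
pose a j := (x (o j), x (ordS (o j))).
suff : mkseq a n.+1 = [::] by [].
apply: EF => [_ /mapP[j + ->]|].
  rewrite mem_iota => /andP[_ jn]; split; last exact: x_neq.
  by apply: xE; rewrite oE //= odd_double.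
rewrite (cycle_path (a 0%N)); apply/(pathP (a 0%N)) => j.
rewrite size_mkseq => jn; apply/asboolP.
pose e := inord j.*2 : 'I_(n.+1.*2).
have eE : e = j.*2 :> nat by rewrite inordK // ltnS leqW // leq_double.
have -> : nth (a 0%N) (mkseq a n.+1) j = a j by rewrite nth_mkseq.
have -> : (a j).1 = x (ordS e).
  by congr x; apply: val_inj; rewrite /= oE // eE modn_small // ltn_Sdouble.
have -> : (nth (a 0%N) (last (a 0%N) (mkseq a n.+1) :: mkseq a n.+1) j).2 = x e.
  case: j => [|j] in jn e eE *; last first.
    rewrite [nth _ _ _]/= nth_mkseq 1?ltnW //; congr x; apply: val_inj.
    by rewrite /= oE 1?ltnW // eE -doubleS modn_small // ltn_double.
  rewrite -[nth _ _ _]/(last (a 0%N) (mkseq a n.+1)) -nth_last size_mkseq.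
  rewrite nth_mkseq //; congr x.
  by apply: val_inj; rewrite /= oE // eE -doubleS modnn.
by split; [apply: xF; rewrite eE odd_double | exact: x_neq].
Qed.

End AlternatingCycles.

(** * Reduced words and chains of blocks *)

Section Words.
Variables (G : groupType) (k : nat) (v : 'I_k -> G).
Implicit Types (s t : seq ('I_k * bool)) (K : set G).

(** Reducedness only concerns adjacent letters, so reduced words glue along a
    non-empty overlap. *)
Lemma reduced_word_overlap s1 s2 s3 :
  s2 != [::] -> reduced_word (s1 ++ s2) -> reduced_word (s2 ++ s3) ->
  reduced_word (s1 ++ s2 ++ s3).
Proof.
case: s2 => [//|y q] _; rewrite /reduced_word.
case: s1 => [//|x p] /=; rewrite !cat_path /= => /and3P[xp py _] yq.
by rewrite xp py cat_path.
Qed.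

Lemma reduced_word_nseq n (c : 'I_k * bool) : reduced_word (nseq n c).
Proof.
case: c => i b; rewrite /reduced_word; case: n => [//|n] /=.
elim: n => [//|n IHn] /=; rewrite IHn andbT.
by rewrite xpair_eqE negb_and; case: b {IHn}; rewrite orbT.
Qed.

Lemma eval_word_cat s t :
  eval_word v (s ++ t) = (eval_word v s * eval_word v t)%g.
Proof. exact: big_cat. Qed.

Lemma eval_word_nseq n (c : 'I_k * bool) :
  eval_word v (nseq n c) = ((if c.2 then v c.1 else (v c.1)^-1) ^+ n)%g.
Proof.
elim: n => [|n IHn] /=; first by rewrite /eval_word big_nil expg0.
by rewrite expgS -IHn /eval_word big_cons.
Qed.

Lemma free_basis_eval_neq1 K s :
  free_basis v K -> reduced_word s -> s != [::] -> eval_word v s <> 1%g.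
Proof.
move=> [_ v_inj _] rs s0 s1; move/eqP: s0; apply.
apply: v_inj; rewrite ?inE //=.
by rewrite s1 /eval_word big_nil.
Qed.

Lemma free_basis_eval_mem K s :
  free_basis v K -> reduced_word s -> K (eval_word v s).
Proof. by move=> [vK _ _] rs; apply: vK. Qed.

End Words.

(** A block [(p, s)] stands for the move from the point [p] to its image under
    the value of the non-empty reduced word [s]. *)
Section Blocks.
Context d (X : measurableType d) (G : groupType) (a : G -> X -> X).
Variables (H K : set G) (k : nat) (v : 'I_k -> G) (B : set X).
Variable F : set (X * X).
Hypotheses (actH : is_action H a) (KH : K `<=` H) (vK : free_basis v K).
Hypothesis freeB :
  forall x h, B x -> H h -> h <> 1%g -> a h x <> x.

Let block : Type := (X * seq ('I_k * bool))%type.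
Implicit Types (b c : block) (l : seq block).

(** The endpoints of the move [b]. *)
Let block_edge b : X * X := (b.1, a (eval_word v b.2) b.1).

Let good : pred block := fun b =>
  `[< [/\ B (block_edge b).1, B (block_edge b).2,
         reduced_word b.2 & b.2 != [::]] >].

(** Consecutive blocks are joined by an [F]-edge; when that edge is degenerate,
    the two words multiply without cancellation. *)
Definition block_link : rel block := fun b c =>
  `[< F ((block_edge b).2, c.1) /\
      ((block_edge b).2 <> c.1 \/ reduced_word (c.2 ++ b.2)) >].

Let strict_link : rel block := relpre block_edge (proper_link F).

Let act_cat b s : reduced_word b.2 -> reduced_word s ->
  a (eval_word v (s ++ b.2)) b.1 = a (eval_word v s) (block_edge b).2.
Proof.
move=> rb rs; rewrite eval_word_cat (actH.2 _ _) //;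
  by apply: KH; exact: free_basis_eval_mem vK _.
Qed.

Let good_neq b : good b -> (block_edge b).1 <> (block_edge b).2.
Proof.
move=> /asboolP[Bb _ rb b0] /esym; apply: freeB => //.
  by apply: KH; exact: free_basis_eval_mem vK _.
exact: free_basis_eval_neq1 vK _ _.
Qed.

(** The block obtained by running through [b] and then through [c]. *)
Let merge b c : block := (b.1, c.2 ++ b.2).

Let good_merge b c : good b -> good c -> (block_edge b).2 = c.1 ->
  reduced_word (c.2 ++ b.2) ->
  good (merge b c) /\ (block_edge (merge b c)).2 = (block_edge c).2.
Proof.
move=> /asboolP[Bb _ rb b0] /asboolP[_ Bc rc c0] bc rcb.
have mE : (block_edge (merge b c)).2 = (block_edge c).2.
  by rewrite /= act_cat // bc.
split=> //; apply/asboolP; rewrite mE; split=> //=.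
by case: (c.2) c0.
Qed.

(** Merging all pairs of blocks joined by a degenerate [F]-edge turns a chain of
    blocks into a chain with the same ends all of whose [F]-edges are
    non-degenerate; the first word still ends, and the last word still begins,
    as before. *)
Let strict_chain b l : all good (b :: l) -> path block_link b l ->
  exists b' l', [/\ all good (b' :: l'), path strict_link b' l',
    b'.1 = b.1 /\ (block_edge (last b' l')).2 = (block_edge (last b l)).2,
    exists t, b'.2 = t ++ b.2 &
    exists t, (last b' l').2 = (last b l).2 ++ t].
Proof.
elim: l b => [|c l IHl] b.
  move=> gb _; exists b, [::]; split => //; first by exists [::].
  by exists [::]; rewrite cats0.
move=> /= /andP[gb gcl] /andP[/asboolP[Fbc bc] cl].
have [c' [l' [gcl' cl' [c'1 lastE] [t tE] [u uE]]]] := IHl c gcl cl.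
have [bc1|bc1] := eqVneq (block_edge b).2 c.1; last first.
  exists b, (c' :: l'); split => //=.
  - by rewrite gb.
  - by rewrite cl' andbT; apply/asboolP; rewrite /= c'1; split=> //; apply/eqP.
  - by exists [::].
  - by exists u.
have /andP[gc' gl'] := gcl'.
have rc'b : reduced_word (c'.2 ++ b.2).
  rewrite tE -catA; apply: reduced_word_overlap.
  - by have /andP[/asboolP[]] := gcl.
  - by rewrite -tE; have /asboolP[] := gc'.
  - by case: bc.
have [gm mE] := good_merge gb gc' (etrans bc1 (esym c'1)) rc'b.
exists (merge b c'), l'; split.
- by rewrite /= gm.
- case: l' cl' {gcl' gl' lastE uE} => //= e l'.
  by rewrite /strict_link /= /proper_link mE.
- split=> //; transitivity (block_edge (last c' l')).2; last exact: lastE.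
  by case: l' {gcl' cl' gl' lastE uE}.
- by exists c'.2.
- case: l' {gcl' cl' gl' lastE} uE => [|e l'] /= uE; last by exists u.
  by exists (u ++ b.2); rewrite uE catA.
Qed.

Let no_strict_cycle l :
  orthogonal_relations (restrict_relation (orbit_relation K a) B)
                       (restrict_relation F B) ->
  all good l -> cycle strict_link l -> l = [::].
Proof.
move=> orth gl cl; suff : map block_edge l = [::] by case: (l).
apply: (orthogonal_no_cycle orth) => [e /mapP[b /(allP gl) gb ->]|].
  split; last exact: good_neq.
  have /asboolP[Bb1 Bb2 rb _] := gb.
  split=> //; exists (eval_word v b.2) => //; exact: free_basis_eval_mem vK _.
rewrite cycle_map; apply: sub_in_cycle gl cl => b c.
move=> /asboolP[_ Bb _ _] /asboolP[Bc _ _ _] /asboolP[Fbc neq].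
by apply/asboolP.
Qed.

(** After the merging above, only the edge closing the cycle can be degenerate;
    then the last block is merged with the first one.  If a single block is
    left, then its word fixes a point, which is excluded as the action is free
    on [B]. *)
Lemma no_block_cycle l :
  orthogonal_relations (restrict_relation (orbit_relation K a) B)
                       (restrict_relation F B) ->
  {in l, forall b, [/\ B b.1, B (a (eval_word v b.2) b.1),
                      reduced_word b.2 & b.2 != [::]]} ->
  cycle block_link l -> l = [::].
Proof.
move=> orth gl cl.
have {}gl : all good l.
  by apply/allP => b /gl[Bb1 Bb2 rb b0]; exact/asboolP.
case: l => [//|b l] in gl cl *.
move: cl; rewrite /= rcons_path => /andP[bl /asboolP[Flb lb]].
have [b' [l' [gl' bl' [b'1 lastE] [t tE] [u uE]]]] := strict_chain gl bl.
have [eqlb|neqlb] := eqVneq (block_edge (last b l)).2 b.1; last first.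
  suff : b' :: l' = [::] by [].
  apply: no_strict_cycle => //=; rewrite rcons_path bl' /=.
  apply/asboolP.
  change (F ((block_edge (last b' l')).2, b'.1) /\
          (block_edge (last b' l')).2 <> b'.1).
  by rewrite b'1 lastE; split=> //; apply/eqP.
have {lb}rb : reduced_word (b.2 ++ (last b l).2).
  by case: lb.
case/lastP: l' => [|l'' z] in gl' bl' lastE uE.
  have /andP[/good_neq] := gl'; case.
  by rewrite [LHS]/= b'1 -eqlb -lastE.
move: gl' bl' lastE uE.
rewrite -rcons_cons all_rcons rcons_path last_rcons => /and3P[gz gb' gl''].
move=> /andP[bl'' zl] lastE uE.
have good_last : good (last b l).
  by apply: (allP gl); exact: mem_last.
have rbz : reduced_word (b'.2 ++ z.2).
  rewrite tE uE; apply: reduced_word_overlap.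
  - by have /asboolP[] := good_last.
  - rewrite -catA; apply: reduced_word_overlap => //.
      by have /andP[/asboolP[]] := gl.
    by rewrite -tE; have /asboolP[] := gb'.
  - by rewrite -uE; have /asboolP[] := gz.
have zb' : (block_edge z).2 = b'.1 by rewrite b'1 lastE.
have [gm mE] := good_merge gz gb' zb' rbz.
suff : merge z b' :: l'' = [::] by [].
apply: no_strict_cycle => //=; first by rewrite gm.
have strict_merge c : strict_link (merge z b') c = strict_link b' c.
  by rewrite /strict_link /relpre /= /proper_link mE.
rewrite rcons_path; apply/andP; split.
  by case: l'' bl'' {gl'' zl} => //= e l''; rewrite strict_merge.
case/lastP: l'' zl {gl'' bl''} => [|l'' e]; last by rewrite !last_rcons.
by rewrite [last _ _]/= strict_merge.
Qed.

End Blocks.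

(** * Finite discrete spaces *)

HB.instance Definition _ n := isPointed.Build 'I_n.+1 ord0.
HB.instance Definition _ n := hasNbhs.Build 'I_n.+1 principal_filter.
HB.instance Definition _ n := Discrete_ofNbhs.Build 'I_n.+1 erefl.
HB.instance Definition _ n := DiscreteUniform_ofNbhs.Build 'I_n.+1.
HB.instance Definition _ (R : numDomainType) n :=
  @DiscretePseudoMetric_ofUniform.Build R 'I_n.+1.
HB.instance Definition _ n := @isMeasurable.Build default_measure_display
  'I_n.+1 discrete_measurable discrete_measurable0
  discrete_measurableC discrete_measurableU.

Lemma discrete_complete (U : discreteUniformType) (F : set_system U) :
  ProperFilter F -> cauchy F -> exists x : U, F --> x.
Proof.
move=> FF Fc.
have [[A B]/= [FA FB] AB] : filter_prod F F [set xy | xy.1 = xy.2].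
  apply: Fc; rewrite uniform_discrete => _ [x _ <-]; exact: erefl.
have [x Ax] := filter_ex FA; exists x.
have -> : nbhs x = principal_filter x by rewrite nbhs_principalE.
move=> C /principal_filterP Cx.
by apply: filterS FB => y By; have <- : x = y by apply: (AB (x, y)).
Qed.

HB.instance Definition _ n := Uniform_isComplete.Build 'I_n.+1
  (fun F FF Fc => (cvg_ex F).2 (discrete_complete FF Fc)).

(** The hypothesis says that [f] is uniformly continuous. *)
Lemma cauchy_map_entourage (U V : uniformType) (f : U -> V)
    (F : set_system U) :
  (forall A, entourage A -> entourage [set xy | A (f xy.1, f xy.2)]) ->
  Filter F -> cauchy F -> cauchy (f @ F).
Proof.
move=> fU FF Fc A /fU /Fc [[P Q]/= [FP FQ] PQ].
exists (f @` P, f @` Q) => /=.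
  by split; [apply: filterS FP | apply: filterS FQ]; exact: preimage_image.
by move=> [_ _] /= [[x Px <-] [y Qy <-]]; exact: (PQ (x, y)).
Qed.

HB.instance Definition _ (U V : puniformType) := Pointed.on (U * V)%type.

Lemma prod_complete (U V : completeType) (F : set_system (U * V)) :
  ProperFilter F -> cauchy F -> cvg F.
Proof.
move=> FF Fc.
have c1 : cvg (fst @ F).
  apply/cauchy_cvgP; apply: cauchy_map_entourage => // A entA.
  apply: filterS (prod_entP entA entourageT) => xy [Axy _].
  exact: Axy.
have c2 : cvg (snd @ F).
  apply/cauchy_cvgP; apply: cauchy_map_entourage => // A entA.
  apply: filterS (prod_entP entourageT entA) => xy [_ Axy].
  exact: Axy.
apply/cvg_ex; exists (lim (fst @ F), lim (snd @ F)) => A [[P Q]/= [nP nQ] PQA].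
have F1 : F (fst @^-1` P) by exact: c1.
have F2 : F (snd @^-1` Q) by exact: c2.
apply: (@filterS _ F _ _ _ _ (filterI F1 F2)) => -[x y] /= [Px Qy].
exact: PQA.
Qed.

HB.instance Definition _ (U V : completeType) :=
  Uniform_isComplete.Build (U * V)%type (@prod_complete U V).

HB.instance Definition _ (R : numDomainType)
    (U V : completePseudoMetricType R) :=
  Complete.on (U * V)%type.


(** * Standard Borel spaces *)

Lemma countable_bigcup_measurable d (T : measurableType d) (I : Type)
    (D : set I) (F : I -> set T) :
  countable D -> (forall i, D i -> measurable (F i)) ->
  measurable (\bigcup_(i in D) F i).
Proof.
move=> cD mF; rewrite bigcup_set_type; apply: countable_bigcupT_measurable.
  by rewrite (eq_countable (card_setT D)).
by move=> i; apply: mF; exact: set_valP.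
Qed.

Lemma hausdorff_prod (U V : topologicalType) :
  hausdorff_space U -> hausdorff_space V -> hausdorff_space (U * V)%type.
Proof.
move=> hU hV [x1 x2] [y1 y2] xy; congr pair.
  apply: hU => A B Ax By.
  have [||[z1 z2] [Az Bz]] := xy (fst @^-1` A) (fst @^-1` B).
  - exact: (@cvg_fst _ _ (nbhs x1) (nbhs x2)).
  - exact: (@cvg_fst _ _ (nbhs y1) (nbhs y2)).
  - by exists z1.
apply: hV => A B Ax By.
have [||[z1 z2] [Az Bz]] := xy (snd @^-1` A) (snd @^-1` B).
- exact: (@cvg_snd _ _ (nbhs x1) (nbhs x2)).
- exact: (@cvg_snd _ _ (nbhs y1) (nbhs y2)).
- by exists z2.
Qed.

Lemma openX (U V : topologicalType) (A : set U) (B : set V) :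
  open A -> open B -> open (A `*` B).
Proof.
rewrite !openE => oA oB [x y] [/= /oA Ax /oB By].
by exists (A, B).
Qed.

Lemma second_countable_prod (U V : topologicalType) :
  @second_countable U -> @second_countable V -> @second_countable (U * V)%type.
Proof.
move=> [B cB [oB bB]] [C cC [oC bC]].
exists ((fun AD => AD.1 `*` AD.2) @` (B `*` C)).
  by apply: (card_le_trans (card_image_le _ _)); exact: countableX.
split=> [_ [[A D] [/oB oA /oC oD] <-]|[x y] W]; first exact: openX.
move=> [[P Q]/= [/bB [A [BA Ax] AP] /bC [D [CD Dy] DQ]] PQW].
exists (A `*` D); last by move=> [x' y'] [/= /AP ? /DQ ?]; apply: PQW.
by split=> //; exists (A, D).
Qed.

Lemma second_countable_discrete (U : discreteTopologicalType) :
  countable [set: U] -> @second_countable U.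
Proof.
move=> cU; exists (range (@set1 U)).
  by apply: (card_le_trans (card_image_le _ _)).
split=> [_ [x _ <-]|x W]; first exact: discrete_open.
move=> /nbhs_singleton Wx; exists [set x]; last by move=> _ ->.
by split => //; exists x.
Qed.

Lemma image_cancel (T U : Type) (f : T -> U) (g : U -> T) (A : set T) :
  cancel f g -> cancel g f -> f @` A = g @^-1` A.
Proof.
move=> fK gK; apply/seteqP; split=> [_ [x Ax <-]|y Agy] /=; first by rewrite fK.
by exists (g y); rewrite ?gK.
Qed.

Section StandardBorel.
Context (R : realType) d (X : measurableType d).

(** If [B] is a countable basis of the topology, two points differ if and only
    if some member of [B] contains the first but not the second. *)
Lemma standard_borel_diagonal :
  standard_borel R X -> measurable [set p : X * X | p.1 = p.2].
Proof.
move=> [T [f [T2 [B cB [oB bB]] [g fK gK] mX]]].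
have mf A : open A -> measurable (f @^-1` A).
  move=> oA; apply/mX; rewrite image_preimage; last first.
    by apply/seteqP; split=> // y _; exists (g y).
  exact: sub_sigma_algebra.
pose S := \bigcup_(A in B) ((f @^-1` A) `*` ~` (f @^-1` A)).
have -> : [set p : X * X | p.1 = p.2] = ~` S.
  apply/seteqP; split=> [[x y] /= -> [A _ [/= Ay nAy]] //|[x y] /= nS].
  apply: contrapT => xy; apply: nS.
  have fxy : f x != f y by apply/eqP => /(can_inj fK).
  have [A [oA /set_mem Ax /set_mem nAy]] := hausdorff_accessible T2 fxy.
  have [C [BC Cx] CA] := bB (f x) _ (open_nbhs_nbhs (conj oA Ax)).
  by exists C => //; split => //= /CA.
apply/measurableC/countable_bigcup_measurable => // A /oB/mf mA.
by apply: measurableX => //; exact: measurableC.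
Qed.

Lemma standard_borel_prod_ord n :
  standard_borel R X -> standard_borel R (X * 'I_n.+1)%type.
Proof.
move=> [T [f [T2 Tc [g fK gK] mX]]].
pose f' (p : X * 'I_n.+1) := (f p.1, p.2).
pose g' (p : T * 'I_n.+1) := (g p.1, p.2).
have fK' : cancel f' g' by move=> [x i]; rewrite /g' /= fK.
have gK' : cancel g' f' by move=> [x i]; rewrite /f' /= gK.
have imE (A : set X) : f @` A = g @^-1` A.
  exact: image_cancel.
exists (T * 'I_n.+1)%type, f'; split.
- exact: hausdorff_prod T2 discrete_hausdorff.
- apply: (second_countable_prod Tc); apply: second_countable_discrete.
  exact: countableP.
- by exists g'.
move=> A; have -> : f' @` A = g' @^-1` A by exact: image_cancel.
pose BT := g_sigma_algebraType (@open T).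
pose BY := g_sigma_algebraType (@open (T * 'I_n.+1)%type).
have mg : measurable_fun setT (g : BT -> X).
  by move=> _ C mC; rewrite setTI -imE; apply/mX.
have mfst : measurable_fun setT (fst : BY -> BT).
  apply: (@measurability _ _ BY BT _ _ (@open T)) => // _ [C oC <-].
  rewrite setTI; apply: sub_sigma_algebra.
  have -> : fst @^-1` C = C `*` [set: 'I_n.+1] by rewrite setXT.
  by apply: openX => //; exact: openT.
have msnd : measurable_fun setT (snd : BY -> 'I_n.+1).
  move=> _ C _; rewrite setTI; apply: sub_sigma_algebra.
  have -> : snd @^-1` C = [set: T] `*` C by rewrite setTX.
  by apply: openX; [exact: openT | exact: discrete_open].
have mg' : measurable_fun setT (g' : BY -> X * 'I_n.+1).
  by apply: measurable_fun_pair => //; exact: measurableT_comp mg mfst.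
have mf' : measurable_fun setT (f' : X * 'I_n.+1 -> BY).
  apply: (@measurability _ _ _ BY _ _ (@open (T * 'I_n.+1)%type)) => //.
  move=> _ [C oC <-]; rewrite setTI.
  have -> : f' @^-1` C =
      \bigcup_i ((f @^-1` [set t | C (t, i)]) `*` [set i]).
    apply/seteqP; split=> [[x i] Cxi|[x i] [_ _ [/= Cxi ->]]] //.
    by exists i => //; split.
  apply: countable_bigcupT_measurable => [|i]; first exact: countableP.
  apply: measurableX => //.
  apply/mX; rewrite imE; apply: sub_sigma_algebra.
  have -> : g @^-1` (f @^-1` [set t | C (t, i)]) = [set t | C (t, i)].
    by apply/seteqP; split=> t /=; rewrite gK.
  move: oC; rewrite !openE => oC t /oC [[P Q]/= [nP nQ] PQC].
  apply: filterS nP => s Ps; apply: (PQC (s, i)); split=> //.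
  exact: nbhs_singleton.
split=> [mA|mA]; first by have := mg' measurableT A mA; rewrite setTI.
have := mf' measurableT _ mA; rewrite setTI.
congr measurable; apply/seteqP; split=> p /=; by rewrite fK'.
Qed.

End StandardBorel.

Lemma orbit_relation_measurable (R : realType) (G : groupType) (H : set G) d
    (X : measurableType d) (a : G -> X -> X) :
  standard_borel R X -> countable H ->
  (forall h, H h -> measurable_fun setT (a h)) ->
  measurable (orbit_relation H a).
Proof.
move=> sX cH ma.
have -> : orbit_relation H a =
    \bigcup_(h in H) ((fun p : X * X => (a h p.1, p.2)) @^-1`
                        [set p | p.1 = p.2]) by [].
apply: countable_bigcup_measurable => // h Hh.
rewrite -[X in measurable X]setTI.
apply: measurable_fun_pair => //; last exact: standard_borel_diagonal sX.
by apply: measurableT_comp => //; exact: ma.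
Qed.

(** * Actions of countable groups *)

Section Subgroups.
Context (G : groupType) (H : set G).
Hypothesis sgH : subgroup H.

Lemma subgroup1 : H 1%g.
Proof. by case: sgH => /set_mem. Qed.

Lemma subgroupV x : H x -> H x^-1%g.
Proof. by move=> Hx; apply/set_mem/(group_closedV sgH)/mem_set. Qed.

Lemma subgroupM x y : H x -> H y -> H (x * y)%g.
Proof.
by move=> Hx Hy; apply/set_mem/(group_closedM sgH); exact/mem_set.
Qed.

Lemma subgroupX x m : H x -> H (x ^+ m)%g.
Proof.
move=> Hx; elim: m => [|m IHm]; first exact: subgroup1.
by rewrite expgS; exact: subgroupM.
Qed.

End Subgroups.

Lemma subgroupP (G : groupType) (H : set G) :
  H 1%g -> (forall x y, H x -> H y -> H (x * y^-1)%g) -> subgroup H.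
Proof.
move=> H1 HM; split; first exact/mem_set.
by move=> x y /set_mem Hx /set_mem Hy; apply/mem_set; exact: HM.
Qed.

Lemma subgroup_setT (G : groupType) : subgroup [set: G].
Proof. exact: subgroupP. Qed.

Lemma generated_subgroup_subgroup (G : groupType) (A : set G) :
  subgroup (generated_subgroup A).
Proof.
apply: subgroupP => [L [sgL _]|x y Ax Ay L [sgL AL]]; first exact: subgroup1.
by apply: subgroupM => //; [apply: Ax|apply: subgroupV => //; apply: Ay].
Qed.

Section Orbits.
Context (R : realType) (G : groupType) (H : set G) d (X : measurableType d).
Variable a : G -> X -> X.
Hypotheses (sgH : subgroup H) (actH : is_action H a).

Lemma is_actionK h : H h -> cancel (a h) (a h^-1%g).
Proof.
move=> Hh x; rewrite -actH.2 ?mulVg ?actH.1 //; exact: subgroupV.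
Qed.

Lemma is_actionKV h : H h -> cancel (a h^-1%g) (a h).
Proof.
move=> Hh x; rewrite -actH.2 ?mulgV ?actH.1 //; exact: subgroupV.
Qed.

Lemma orbit_relation_equivalence : equivalence_relation (orbit_relation H a).
Proof.
split=> [x|x y [h Hh /= <-]|x y z [h Hh /= <-] [h' Hh' /= <-]].
- by exists 1%g; [exact: subgroup1|exact: actH.1].
- by exists h^-1%g; [exact: subgroupV|exact: is_actionK].
- by exists (h' * h)%g; [exact: subgroupM|exact: actH.2].
Qed.

Lemma orbit_relation_borel :
  standard_borel R X -> countable H ->
  (forall h, H h -> measurable_fun setT (a h)) ->
  borel_equivalence (orbit_relation H a).
Proof.
move=> sX cH ma; split; first exact: orbit_relation_measurable sX cH ma.
exact: orbit_relation_equivalence.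
Qed.

Lemma orbit_relation_mp (mu : probability X R) :
  standard_borel R X -> countable H -> pmp_action H mu a ->
  mp_relation mu (orbit_relation H a).
Proof.
move=> sX /countable_injP[f f_inj] [_ ma mua].
have bE : borel_equivalence (orbit_relation H a).
  by apply: orbit_relation_borel => //; apply/countable_injP; exists f.
split=> //.
(* [e] enumerates H along the injection [f], with repetitions of 1. *)
pose e n := xget 1%g [set h | H h /\ f h = n].
have He n : H (e n).
  by rewrite /e; case: xgetP => [h _ []//|_]; exact: subgroup1.
have eK h : H h -> e (f h) = h.
  move=> Hh; rewrite /e; case: xgetP => [h' _ [Hh' ff]|/(_ h)[]//].
  by apply: f_inj => //; exact/mem_set.
exists nat, (fun n => PartialMap setT (a (e n))); split; last first.
  move=> n C mC _ /=.
  rewrite (image_cancel _ (is_actionK (He n)) (is_actionKV (He n))).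
  by apply: mua => //; exact: subgroupV.
split=> [n|].
  split=> //=; first by move=> x y _ _ /(can_inj (is_actionK (He n))).
    exact: ma.
  move=> C mC _.
  rewrite (image_cancel _ (is_actionK (He n)) (is_actionKV (He n))).
  rewrite -[X in measurable X]setTI.
  by apply: ma => //; exact: subgroupV.
split=> //.
have -> : graph_pairs (fun n => PartialMap setT (a (e n))) = orbit_relation H a.
  apply/seteqP; split=> [[x y] [n _ /= ->]|[x y] [h Hh /= <-]].
    by exists (e n).
  by exists (f h) => //=; rewrite eK.
by rewrite smallest_id.
Qed.

End Orbits.

(** * Finitely many copies of a probability space *)

Lemma measurable_fun_prod_ord d (X : measurableType d) d'
    (Y : measurableType d') n (f : X * 'I_n.+1 -> Y) :
  (forall c, measurable_fun setT (fun x => f (x, c))) -> measurable_fun setT f.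
Proof.
move=> mf _ A mA; rewrite setTI.
have -> : f @^-1` A = \bigcup_c (((fun x => f (x, c)) @^-1` A) `*` [set c]).
  apply/seteqP; split=> [[x c] Ax|[x c] [_ _ [/= Ax ->]]] //.
  by exists c => //; split.
apply: countable_bigcupT_measurable => [|c]; first exact: countableP.
by apply: measurableX => //; rewrite -[X in measurable X]setTI; exact: mf.
Qed.

Section SheetMeasure.
Context (R : realType) d (X : measurableType d).
Context (mu : probability X R) (n : nat).

Let sheet (c : 'I_n.+1) (x : X) : X * 'I_n.+1 := (x, c).

Let measurable_sheet c : measurable_fun setT (sheet c).
Proof. by apply: measurable_fun_pair. Qed.

Let sheet_measure (c : 'I_n.+1) : {measure set (X * 'I_n.+1) -> \bar R}.
Proof. by refine (pushforward mu (sheet c)); exact: measurable_sheet. Defined.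

(** The mean of the copies of [mu] on the [n.+1] copies of [X]. *)
Definition copies_measure : set (X * 'I_n.+1) -> \bar R :=
  mscale (n.+1%:R^-1)%:nng (msum (fun i => sheet_measure (inord i)) n.+1).

HB.instance Definition _ := Measure.on copies_measure.

Lemma copies_measureE A : copies_measure A =
  ((n.+1%:R^-1)%:E * \sum_(c < n.+1) mu [set x | A (x, c)])%E.
Proof.
congr (_ * _)%E; apply: eq_bigr => c _.
by rewrite /= /pushforward inord_val.
Qed.

Let copies_measure_setT : copies_measure setT = 1%E.
Proof.
rewrite copies_measureE.
under eq_bigr do rewrite (_ : [set x | setT (x, _)] = setT) // probability_setT.
rewrite sumEFin sumr_const card_ord -EFinM mulVf //.
Qed.

HB.instance Definition _ :=
  Measure_isProbability.Build _ _ _ copies_measure copies_measure_setT.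

Lemma copies_measure_negligible (A : set X) :
  mu.-negligible A -> copies_measure.-negligible [set p | A p.1].
Proof.
move=> [B [mB muB AB]]; exists (B `*` setT); split.
- exact: measurableX.
- rewrite copies_measureE (eq_bigr (fun=> 0%E)); last first.
    move=> c _; rewrite -muB; congr (mu _).
    by apply/seteqP; split=> x //= [].
  by rewrite big1 ?mule0.
- by move=> [x c] /= /AB.
Qed.

End SheetMeasure.
Arguments copies_measure {R d X} mu n.
Arguments copies_measure_negligible {R d X mu} n A.

(** * Induced actions *)

(** The elements [r c] represent each left coset of [H] exactly once. *)
Definition left_transversal (G : groupType) (H : set G) n
    (r : 'I_n.+1 -> G) : Prop :=
  forall x, exists! c, H ((r c)^-1 * x)%g.

Section InducedAction.
Context (R : realType) (G : groupType) (H : set G) d (X : measurableType d).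
Context (mu : probability X R) (a : G -> X -> X) (n : nat) (r : 'I_n.+1 -> G).
Hypotheses (sgH : subgroup H) (rH : left_transversal H r).

(** The index [c] of the coset of [x]; the default value is never used when [r]
    is a left transversal. *)
Definition coset_index (x : G) : 'I_n.+1 :=
  xget ord0 [set c | H ((r c)^-1 * x)%g].

Lemma coset_indexP x : H ((r (coset_index x))^-1 * x)%g.
Proof.
by rewrite /coset_index; case: xgetP => // /= nH; have [c [/nH]] := rH x.
Qed.

Lemma coset_index_mul c h : H h -> coset_index (r c * h)%g = c.
Proof.
move=> Hh; have [e [_ eU]] := rH (r c * h)%g.
by rewrite -(eU _ (coset_indexP _)); apply: eU; rewrite mulKg.
Qed.

Lemma transversal_inj c c' : H ((r c)^-1 * r c')%g -> c = c'.
Proof.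
move=> /(coset_index_mul c) <-; rewrite mulVKg -[r c']mulg1.
by rewrite coset_index_mul //; exact: subgroup1.
Qed.

(** The action of [G] induced by the action [a] of [H], on copies of [X] indexed
    by [G / H]: if [g * r c = r e * h] with [h] in [H], then [g] sends [(x, c)]
    to [(a h x, e)]. *)
Definition induced_action (g : G) (p : X * 'I_n.+1) : X * 'I_n.+1 :=
  let e := coset_index (g * r p.2)%g in
  (a ((r e)^-1 * (g * r p.2))%g p.1, e).

Lemma induced_actionE g x c h e : H h -> (g * r c = r e * h)%g ->
  induced_action g (x, c) = (a h x, e).
Proof.
by move=> Hh gE; rewrite /induced_action /= gE coset_index_mul // mulKg.
Qed.

Lemma induced_actionP g x c : exists h e,
  [/\ H h, (g * r c = r e * h)%g & induced_action g (x, c) = (a h x, e)].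
Proof.
pose e := coset_index (g * r c)%g.
exists ((r e)^-1 * (g * r c))%g, e; split; rewrite ?mulVKg //.
exact: coset_indexP.
Qed.

Lemma induced_is_action : is_action H a -> is_action setT induced_action.
Proof.
move=> [a1 aM]; split=> [[x c]|g g' _ _ [x c]].
  rewrite (@induced_actionE _ _ _ 1%g c) ?a1 ?mul1g ?mulg1 //.
  exact: subgroup1.
have [h [e [Hh gE ->]]] := induced_actionP g' x c.
have [h' [e' [Hh' gE' ->]]] := induced_actionP g (a h x) e.
rewrite -aM //; apply: induced_actionE; first exact: subgroupM.
by rewrite -mulgA gE mulgA gE' mulgA.
Qed.

Lemma induced_pmp_action :
  pmp_action H mu a -> pmp_action setT (copies_measure mu n) induced_action.
Proof.
move=> [acta ma mua]; split=> [|g _|g _ A mA]; first exact: induced_is_action.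
  apply: measurable_fun_prod_ord => c.
  apply: measurable_fun_pair => //=; apply: ma; exact: coset_indexP.
rewrite [LHS]copies_measureE [RHS]copies_measureE; congr (_ * _)%E.
pose s c := coset_index (g * r c)%g.
have s_inj : injective s.
  move=> c c' ss; apply: transversal_inj.
  have -> : ((r c)^-1 * r c' =
      ((r (s c))^-1 * (g * r c))^-1 * ((r (s c'))^-1 * (g * r c')))%g.
    by rewrite ss invgM invgK -!mulgA mulVKg invgM -!mulgA mulKg.
  apply: subgroupM => //; last exact: coset_indexP.
  by apply: subgroupV => //; exact: coset_indexP.
(* [g] permutes the copies by [s] and acts on each of them through [H]. *)
rewrite [RHS](reindex_inj s_inj); apply: eq_bigr => c _.
rewrite -[RHS](mua _ (coset_indexP (g * r c)%g)); last first.
  have mc : measurable_fun setT (fun x : X => (x, s c)).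
    exact: measurable_fun_pair.
  by have := mc measurableT A mA; rewrite setTI.
by [].
Qed.

Lemma induced_free_action :
  free_action H mu a -> free_action setT (copies_measure mu n) induced_action.
Proof.
move=> /(copies_measure_negligible n); apply: negligibleS.
move=> [x c] /= [g [_ g1 gx]].
have [h [e [Hh gE]]] := induced_actionP g x c.
rewrite gx => -[hx ce]; subst e; exists h; split=> // h1; apply: g1.
by apply: (mulIg (r c)); rewrite gE h1 mul1g mulg1.
Qed.

Lemma induced_free_pmp_action :
  free_pmp_action H mu a ->
  free_pmp_action setT (copies_measure mu n) induced_action.
Proof.
move=> [sX pa fa]; split.
- exact: standard_borel_prod_ord.
- exact: induced_pmp_action.
- exact: induced_free_action.
Qed.

End InducedAction.

(** * Cyclic subgroups, cosets and double cosets *)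

Section Powers.
Variables (G : groupType) (w : G).

Lemma cyclic_subgroupP x : generated_subgroup [set w] x ->
  exists m, x = (w ^+ m)%g \/ x = (w ^+ m)^-1%g.
Proof.
have wC i j : commute (w ^+ i)%g (w ^+ j)%g by exact: commuteX2.
pose L := [set x | exists i j, x = (w ^+ i * (w ^+ j)^-1)%g].
have sgL : subgroup L.
  apply: subgroupP => [|_ _ [i [j ->]] [l [m ->]]].
    by exists 0%N, 0%N; rewrite mulgV.
  exists (i + m)%N, (l + j)%N; rewrite !expgnDr !invgM invgK -!mulgA.
  congr (_ * _)%g; rewrite !mulgA; congr (_ * _)%g.
  by apply/esym/commuteV/wC.
move=> /(_ L)[].
  split=> // _ ->; exists 1%N, 0%N.
  by rewrite expg1 expg0 invg1 mulg1.
move=> i [j ->]; have [ij|/ltnW ji] := leqP i j.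
  by exists (j - i)%N; right; rewrite expgnFr // invgM invgK.
by exists (i - j)%N; left; rewrite expgnFr.
Qed.

(** Since [m] is minimal, it divides every [l] such that the conjugate of
    [w ^+ l] lies in [H]. *)
Lemma lift_exponent_powers (H : set G) g m x :
  subgroup H -> lift_exponent w H g m -> generated_subgroup [set w] x ->
  H (g^-1 * x * g)%g ->
  exists q, (g^-1 * x * g = (g^-1 * w ^+ m * g) ^+ q \/
             g^-1 * x * g = ((g^-1 * w ^+ m * g) ^+ q)^-1)%g.
Proof.
move=> sgH [[m_gt0 Hm] m_min].
have cX y q : ((g^-1 * y * g) ^+ q = g^-1 * y ^+ q * g)%g.
  by have := conjXg y g q; rewrite !conjgE !mulgA => ->.
have pow l : H (g^-1 * w ^+ l * g)%g ->
    (g^-1 * w ^+ l * g = (g^-1 * w ^+ m * g) ^+ (l %/ m))%g.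
  move=> Hl; rewrite cX -expgnA mulnC.
  have lE := divn_eq l m; have lt_m := ltn_pmod l m_gt0.
  suff r0 : (l %% m = 0)%N by rewrite {1}lE r0 addn0.
  apply/eqP; rewrite -leqn0 leqNgt; apply/negP => r_gt0.
  suff /(conj r_gt0)/m_min : H (g^-1 * w ^+ (l %% m) * g)%g.
    by rewrite leqNgt lt_m.
  have -> : (g^-1 * w ^+ (l %% m) * g =
      ((g^-1 * w ^+ m * g) ^+ (l %/ m))^-1 * (g^-1 * w ^+ l * g))%g.
    rewrite {3}lE cX -expgnA [(m * _)%N]mulnC expgnDr !invgM invgK -!mulgA.
    by rewrite mulVKg mulKg.
  apply: subgroupM => //; apply: subgroupV => //; exact: subgroupX.
move=> /cyclic_subgroupP[l [->|->]] Hx.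
  by exists (l %/ m)%N; left; exact: pow.
have gV : (g^-1 * (w ^+ l)^-1 * g = (g^-1 * w ^+ l * g)^-1)%g.
  by rewrite !invgM invgK mulgA.
exists (l %/ m)%N; right; rewrite gV; congr (_^-1)%g; apply: pow.
by rewrite -[X in H X]invgK -gV; exact: subgroupV.
Qed.

End Powers.

Section Cosets.
Context (G : groupType) (H : set G).
Hypothesis sgH : subgroup H.

Let coset x : set G := [set (x * h)%g | h in H].

Let coset_eq x y : coset x = coset y <-> H (x^-1 * y)%g.
Proof.
split=> [xy|Hxy].
  have : coset y y by exists 1%g; [exact: subgroup1|rewrite mulg1].
  by rewrite -xy => -[h Hh <-]; rewrite mulKg.
apply/seteqP; split=> [_ [h Hh <-]|_ [h Hh <-]].
  exists ((x^-1 * y)^-1 * h)%g; last by rewrite invgM invgK !mulgA mulgV mul1g.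
  by apply: subgroupM => //; exact: subgroupV.
by exists ((x^-1 * y) * h)%g; [exact: subgroupM|rewrite -mulgA mulVKg].
Qed.

(** A left transversal containing given representatives of distinct cosets. *)
Lemma left_transversal_extending k (g : 'I_k -> G) :
  finite_index H -> (forall i j, H ((g i)^-1 * g j)%g -> i = j) ->
  exists n (r : 'I_n.+1 -> G) (b : 'I_k -> 'I_n.+1),
    left_transversal H r /\ forall i, r (b i) = g i.
Proof.
move=> /finite_seqP[s0 s0E] g_inj; set s := undup s0.
have s_mem x : coset x \in s.
  have : range coset (coset x) by exists x.
  by rewrite s0E /= mem_undup.
have s_uniq : uniq s by exact: undup_uniq.
have [n sz] : exists n, size s = n.+1.
  by have := s_mem 1%g; case: (s) => // D s' _; exists (size s').
pose P D := [set x | coset x = D /\ forall i, D = coset (g i) -> x = g i].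
have ex_rep D : D \in s -> exists x, P D x.
  rewrite mem_undup => sD; have : [set` s0] D by [].
  rewrite -s0E => -[x _ xD].
  have [[i Di]|nD] := pselect (exists i, D = coset (g i)).
    exists (g i); split=> // j Dj; congr g; apply: g_inj.
    by apply/coset_eq; rewrite -Di -Dj.
  by exists x; split=> // i Di; case: nD; exists i.
pose r (c : 'I_n.+1) := xget 1%g (P (nth set0 s c)).
pose idx x : 'I_n.+1 := inord (index (coset x) s).
have idxE x : idx x = index (coset x) s :> nat.
  by rewrite inordK // -sz index_mem.
have rP (c : 'I_n.+1) : P (nth set0 s c) (r c).
  rewrite /r; case: xgetP => // nP.
  by have [|x /nP] := ex_rep (nth set0 s c); rewrite ?mem_nth ?sz.
have nth_idx x : nth set0 s (idx x) = coset x.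
  by rewrite idxE nth_index.
exists n, r, (fun i => idx (g i)); split=> [x|i]; last first.
  by apply: (rP _).2; rewrite nth_idx.
exists (idx x); split; first by apply/coset_eq; rewrite (rP _).1 nth_idx.
move=> c /coset_eq; rewrite (rP _).1 -nth_idx => /eqP.
by rewrite nth_uniq ?sz // => /eqP/val_inj/esym.
Qed.

End Cosets.

Section DoubleCosets.
Context (G : groupType) (A H : set G) (k : nat) (g : 'I_k -> G).
Hypotheses (sgA : subgroup A) (sgH : subgroup H).
Hypothesis g_reps : double_coset_representatives A H g.

Lemma double_coset_repP x :
  exists i u h, [/\ A u, H h & x = (u * g i * h)%g].
Proof.
have [_ _ surj] := g_reps.
have [//|i _ gx] := surj (double_coset A x H); first by exists x.
have : double_coset A x H x.
  exists 1%g; first exact: subgroup1.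
  by exists 1%g; [exact: subgroup1|rewrite mul1g mulg1].
by rewrite -gx => -[u Au [h Hh <-]]; exists i, u, h.
Qed.

Lemma double_coset_rep_inj i j u h :
  A u -> H h -> (u * g i = g j * h)%g -> i = j.
Proof.
move=> Au Hh e; have [_ inj _] := g_reps; apply: inj; rewrite ?inE //.
have gjE : g j = (u * g i * h^-1)%g by rewrite e mulgK.
apply/seteqP; split=> [_ [u' Au' [h' Hh' <-]]|_ [u' Au' [h' Hh' <-]]].
  exists (u' * u^-1)%g; first by apply: subgroupM => //; exact: subgroupV.
  exists (h * h')%g; first exact: subgroupM.
  by rewrite gjE !mulgA mulgVK mulgVK.
exists (u' * u)%g; first exact: subgroupM.
exists (h^-1 * h')%g; first by apply: subgroupM => //; exact: subgroupV.
by rewrite gjE !mulgA.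
Qed.

End DoubleCosets.

(** * The complement of the orbit relation of w *)

Lemma reduced_word_nseq_cat k (c c' : 'I_k * bool) p q :
  c.1 != c'.1 -> reduced_word (nseq p c ++ nseq q c').
Proof.
move=> cc'; have rc := reduced_word_nseq p c.
have rc' := reduced_word_nseq q c'.
case: p rc => [//|p]; case: q rc' => [|q]; first by rewrite cats0.
rewrite /reduced_word /= cat_path /= => -> ->.
have -> : last c (nseq p c) = c by elim: p => //= p; case: p.
rewrite andbT /=; apply: contra cc' => /eqP -> //=.
Qed.

(** On copies of a space indexed by ['I_n.+1], the relation generated by [E'],
    placed on each copy in [D], and the identifications of the copies in [D]
    with one another. *)
Definition spread_relation (X : Type) n (D : set 'I_n.+1) (E' : set (X * X)) :
    set ((X * 'I_n.+1) * (X * 'I_n.+1)) :=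
  [set pq | pq.1 = pq.2 \/ [/\ D pq.1.2, D pq.2.2 & E' (pq.1.1, pq.2.1)]].

Lemma spread_relation_borel (R : realType) d (X : measurableType d) n
    (D : set 'I_n.+1) (E' : set (X * X)) :
  standard_borel R X -> borel_equivalence E' ->
  borel_equivalence (spread_relation D E').
Proof.
move=> sX [mE' [E'r E's E't]]; split; last first.
  rewrite /equivalence_relation /spread_relation /=.
  split=> [p|p q [->|[Dp Dq pq]]|p q s [->|[Dp Dq pq]] //].
  - by left.
  - by left.
  - by right; split=> //; exact: E's.
  - move=> [qs|[Dq' Ds qs]]; right; first by rewrite -qs.
    by split=> //; exact: E't qs.
pose Y := (X * 'I_n.+1)%type.
have mfst : measurable_fun setT (fun pq : Y * Y => (pq.1.1, pq.2.1)).
  by apply: measurable_fun_pair; apply: measurableT_comp.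
have mD (f : Y * Y -> 'I_n.+1) :
    measurable_fun setT f -> measurable (f @^-1` D).
  by move=> mf; rewrite -[X in measurable X]setTI; exact: mf.
have -> : spread_relation D E' = [set pq | pq.1 = pq.2] `|`
    (((fun pq : Y * Y => pq.1.2) @^-1` D) `&`
     ((fun pq : Y * Y => pq.2.2) @^-1` D) `&`
     ((fun pq : Y * Y => (pq.1.1, pq.2.1)) @^-1` E')).
  apply/seteqP; split=> pq; case.
  - by left.
  - by move=> [? ? ?]; right.
  - by left.
  - by move=> [[? ?] ?]; right.
apply: measurableU.
  exact: standard_borel_diagonal (standard_borel_prod_ord n sX).
apply: measurableI.
  apply: measurableI; apply: mD.
    exact: (measurableT_comp measurable_snd measurable_fst).
  exact: (measurableT_comp measurable_snd measurable_snd).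
by rewrite -[X in measurable X]setTI; exact: mfst.
Qed.

Section FreeFactor.
Context (R : realType) (G : groupType) (G_countable : countable [set: G]).
Context (w : G) (H : set G) (sgH : subgroup H).
Context (k : nat) (g v : 'I_k -> G).
Hypothesis g_reps :
  double_coset_representatives (generated_subgroup [set w]) H g.
Hypothesis v_lift : complete_lift w H g v.
Let K := generated_subgroup (range v).
Hypothesis K_free : free_basis v K.
Context (n : nat) (r : 'I_n.+1 -> G) (b : 'I_k -> 'I_n.+1).
Hypotheses (rH : left_transversal H r) (rb : forall i, r (b i) = g i).
Context d (X : measurableType d) (mu : probability X R) (a : G -> X -> X).
Context (E' : set (X * X)).
Hypotheses (aH : free_pmp_action H mu a) (bE' : borel_equivalence E').
Hypothesis HKE' : free_product mu (orbit_relation H a) (orbit_relation K a) E'.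

Let W := generated_subgroup [set w].
Let sgW : subgroup W. Proof. exact: generated_subgroup_subgroup. Qed.
Let Y := (X * 'I_n.+1)%type.
Let ga : G -> Y -> Y := induced_action H a r.
Let E'' : set (Y * Y) := spread_relation (range b) E'.
Let sX : standard_borel R X. Proof. by case: aH. Qed.
Let acta : is_action H a. Proof. by case: aH => _ []. Qed.
Let actga : is_action setT ga. Proof. exact: induced_is_action. Qed.
Let E'_refl x : E' (x, x). Proof. by case: bE' => _ []. Qed.

Let v_in_H i : H (v i).
Proof. by have [m [[_ Hm] _] ->] := v_lift i. Qed.

Let KH : K `<=` H.
Proof. by move=> x; apply; split=> // _ [i _ <-]. Qed.

Let E'H : E' `<=` orbit_relation H a.
Proof. by case: HKE' => _ _ []. Qed.

(** The first return of [w] to the base copy [b i] is [v i]. *)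
Let base_return i x : exists2 u, W u & ga u (x, b i) = (a (v i) x, b i).
Proof.
have [m _ vE] := v_lift i; exists (w ^+ m)%g.
  by apply: (subgroupX sgW) => L [_ wL]; exact: wL.
by apply: induced_actionE => //; rewrite rb vE !mulgA mulgV mul1g.
Qed.

(** Two points of base copies in the same [w]-orbit lie in the same copy [b i]
    and differ by a power of [v i]. *)
Let base_orbit i j x y : orbit_relation W ga ((x, b i), (y, b j)) ->
  exists c q, [/\ c.1 = i, b j = b i & y = a (eval_word v (nseq q c)) x].
Proof.
move=> [u Wu /= uxy].
have [h [e [Hh uE]]] := induced_actionP a rH u x (b i).
rewrite -/ga uxy => -[-> ebj]; subst e; move: uE; rewrite !rb => uE.
have ij := double_coset_rep_inj sgW sgH g_reps Wu Hh uE; subst j.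
have [m mP vE] := v_lift i.
have hE : h = ((g i)^-1 * u * g i)%g by rewrite -mulgA uE mulKg.
have Hu : H ((g i)^-1 * u * g i)%g by rewrite -hE.
have [q] := lift_exponent_powers sgH mP Wu Hu; rewrite -hE -vE.
case=> hq; [exists (i, true), q|exists (i, false), q]; split=> //.
  by rewrite eval_word_nseq /= -hq.
by rewrite eval_word_nseq /= expVgn -hq.
Qed.

Let orbit_sub (L : set G) : orbit_relation L ga `<=` orbit_relation setT ga.
Proof. by move=> p [h _ hp]; exists h. Qed.

Let spread_sub : E'' `<=` orbit_relation setT ga.
Proof.
move=> [p q]; rewrite /E'' /spread_relation /= => -[->|].
  by exists 1%g => //; exact: actga.1.
case: p q => [x c] [y c'] /= [_ _ /E'H [h Hh /= hxy]].
exists (r c' * h * (r c)^-1)%g => //=.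
by rewrite -hxy; apply: induced_actionE => //; rewrite mulgVK.
Qed.

(** Every Borel equivalence relation [F] containing both relations contains the
    orbit relation of [G]: its trace [F0] on a base copy contains [E'] and the
    action of each [v i], hence the orbit relation of [H]. *)
Let generated : borel_generated_by (orbit_relation setT ga)
  (orbit_relation W ga `|` E'').
Proof.
have bG : borel_equivalence (orbit_relation setT ga).
  apply: (@orbit_relation_borel R) => //.
  - exact: subgroup_setT.
  - exact: standard_borel_prod_ord.
  - by case: (induced_pmp_action (mu := mu) (a := a) sgH rH _) => //; case: aH.
split=> //; apply/seteqP; split; last first.
  apply: smallest_sub => // p [|]; [exact: orbit_sub|exact: spread_sub].
move=> [[x c] [y c']] [u _ /= uE] F [[mF [Fr Fs Ft]] SF].
have FW p q : orbit_relation W ga (p, q) -> F (p, q).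
  by move=> ?; apply: SF; left.
have FE p q : E'' (p, q) -> F (p, q).
  by move=> ?; apply: SF; right.
have [i0 _] := double_coset_repP sgW sgH g_reps 1%g.
pose F0 := [set p : X * X | F ((p.1, b i0), (p.2, b i0))].
have bF0 : borel_equivalence F0.
  split; last first.
    split=> [z|z z'|z z' z'']; [exact: Fr|exact: Fs|exact: Ft].
  have mf : measurable_fun setT (fun p : X * X => ((p.1, b i0), (p.2, b i0))).
    by apply: measurable_fun_pair; apply: measurable_fun_pair.
  by have := mf measurableT F mF; rewrite setTI.
have [_ F0s F0t] := bF0.2.
have base i z : F ((z, b i), (z, b i0)).
  by apply: FE; right; split=> /=; [exists i|exists i0|exact: E'_refl].
have F0v i z : F0 (z, a (v i) z).
  apply: (Ft _ _ _ (Fs _ _ (base i z))); apply: (Ft _ _ _ _ (base i _)).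
  by apply: FW; have [u' Wu' u'E] := base_return i z; exists u'.
have F0K : K `<=` [set h | H h /\ forall z, F0 (z, a h z)].
  apply: smallest_sub => [|_ [i _ <-]]; last by split.
  apply: subgroupP => [|h h' [Hh Fh] [Hh' Fh']].
    by split=> [|z]; [exact: subgroup1|rewrite acta.1; exact: Fr].
  split=> [|z]; first by apply: subgroupM => //; exact: subgroupV.
  rewrite acta.2 //; last exact: subgroupV.
  apply: (F0t _ _ _ _ (Fh _)); apply: F0s.
  by have := Fh' (a h'^-1%g z); rewrite (is_actionKV sgH acta Hh').
have F0H : orbit_relation H a `<=` F0.
  have [_ _ _ [_ ->] _] := HKE'; apply: smallest_sub => // -[z z'] [|zz'].
    by move=> [h /F0K[_ Fh] /= <-].
  by apply: FE; right; split=> //=; exists i0.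
have to_base z e : exists2 h, H h & F ((z, e), (a h z, b i0)).
  have [i [u' [h [Wu' Hh re]]]] := double_coset_repP sgW sgH g_reps (r e).
  exists h => //; apply: (Ft _ _ _ _ (base i _)); apply: Fs; apply: FW.
  exists u' => //=.
  rewrite /ga (@induced_actionE _ _ _ _ a _ _ rH _ _ _ h^-1%g e).
  - by rewrite (is_actionK sgH acta).
  - exact: subgroupV.
  - by rewrite re rb mulgK.
have [h Hh zh] := to_base x c; have [h' Hh' zh'] := to_base y c'.
have [h'' [e [Hh'' _]]] := induced_actionP a rH u x c.
rewrite -/ga uE => -[yE _].
apply: (Ft _ _ _ zh); apply: (Ft _ _ _ _ (Fs _ _ zh')).
suff : F0 (a h x, a h' y) by [].
apply: F0H; exists (h' * h'' * h^-1)%g => /=.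
  by apply: subgroupM; [|exact: subgroupM|exact: subgroupV].
rewrite acta.2 ?(is_actionK sgH acta) //; [|exact: subgroupM|exact: subgroupV].
by rewrite acta.2 // -yE.
Qed.

(** A cycle alternating between the two relations visits base copies only;
    forgetting the copies turns it into a cycle of blocks. *)
Let orthogonal B :
  (forall x h, B x -> H h -> h <> 1%g -> a h x <> x) ->
  orthogonal_relations (restrict_relation (orbit_relation K a) B)
                       (restrict_relation E' B) ->
  orthogonal_relations (restrict_relation (orbit_relation W ga) (B `*` setT))
                       (restrict_relation E'' (B `*` setT)).
Proof.
move=> freeB orthB; apply: no_cycle_orthogonal => s sW sE.
have in_base e : e \in s -> range b e.1.2 /\ range b e.2.2.
  move=> es; split.
    by have /asboolP[[[//|[]]]] := prev_cycle sE es.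
  by have /asboolP[[[//|[]]]] := next_cycle sE es.
pose good (e : Y * Y) (t : seq ('I_k * bool)) := exists i c q,
  [/\ c.1 = i, t = nseq q c, e.1.2 = b i, e.2.2 = b i &
      e.2.1 = a (eval_word v t) e.1.1].
have /choice[t tP] e : exists t, e \in s -> good e t.
  have [es|] := boolP (e \in s); last by exists [::].
  have [[i _ bi] [j _ bj]] := in_base e es.
  have [[] + _ _] := sW e es.
  case: e es bi bj => [[x c] [y c']] /= _ <- <-.
  move=> /base_orbit[c0 [q [c0i bji ->]]].
  by exists (nseq q c0) => _; exists i, c0, q; split.
suff : [seq (e.1.1, t e) | e <- s] = [::] by case: (s).
apply: (no_block_cycle acta KH K_free freeB orthB) => [_ /mapP[e es ->]|].
  have [[_ [/= B1 B2]] neq] := sW e es.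
  have [i [c [q [_ tE e1 e2 e21]]]] := tP e es.
  rewrite /= -e21; split; [by case: B1|by case: B2| |].
    by rewrite tE; exact: reduced_word_nseq.
  apply/eqP => t0; apply: neq.
  rewrite [e.1]surjective_pairing [e.2]surjective_pairing e1 e2 e21 t0.
  by rewrite /eval_word big_nil acta.1.
rewrite cycle_map; apply: (@sub_in_cycle _ (mem s)) sE; last exact/allP.
move=> e e' es e's /asboolP[[E''ee' _] neq].
have [i [c [q [ci tE e1 e2 e21]]]] := tP e es.
have [i' [c' [q' [ci' tE' e1' e2' e21']]]] := tP e' e's.
apply/asboolP; rewrite /= -e21; split.
  by case: E''ee' => [//|[]].
have [xx'|] := pselect (e.2.1 = e'.1.1); [right|by left].
rewrite tE tE'; apply: reduced_word_nseq_cat; apply/eqP => cc'; apply: neq.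
rewrite [e.2]surjective_pairing [e'.1]surjective_pairing xx' e2 e1'.
by rewrite -ci -ci' cc'.
Qed.

Lemma induced_free_product :
  free_product (copies_measure mu n) (orbit_relation setT ga)
    (orbit_relation W ga) E''.
Proof.
have [_ _ fa] := aH.
have fpa := induced_free_pmp_action sgH rH aH.
have [sY pY _] := fpa.
have cW : countable W.
  by apply: sub_countable G_countable; exact: subset_card_le.
split.
- exact: (orbit_relation_mp (@subgroup_setT G) actga sY G_countable pY).
- split; last exact: orbit_sub.
  apply: (@orbit_relation_borel R) => //.
    by split=> [|? ? _ _]; [exact: actga.1 | exact: actga.2].
  by move=> h _; case: pY => _ + _; apply.
- split; last exact: spread_sub.
  exact: (@spread_relation_borel R).
- exact: generated.
have [_ _ _ _ [B0 [mB0 muB0 orthB0]]] := HKE'.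
have [M [mM muM subM]] := fa.
(* [M] is a null set containing the points with a non-trivial stabiliser. *)
pose B := B0 `\` M.
have mB : measurable B by exact: measurableD.
have muB : mu B = 1%E.
  have M0 : mu (B0 `&` M) = 0%E.
    by apply: (subset_measure0 (B := M)) => //; exact: measurableI.
  have : mu B0 = (mu B + mu (B0 `&` M))%E by exact: measureDI.
  by rewrite muB0 M0 adde0.
exists (B `*` setT); split.
- exact: measurableX.
- rewrite -[RHS](probability_setT (copies_measure mu n)).
  rewrite [LHS]copies_measureE [RHS]copies_measureE.
  congr (_ * _)%E; apply: eq_bigr => c _.
  transitivity (mu B); last by rewrite muB -(probability_setT mu).
  by congr (mu _); apply/seteqP; split=> x //= [].
apply: orthogonal => [x h [_ nMx] Hh h1 hx|m x m0 xK xE'].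
  by apply: nMx; apply: subM; exists h.
by apply: orthB0 => // i oi; [have := xK i oi|have := xE' i oi];
  move=> [? [[? _] [? _]]]; split.
Qed.

End FreeFactor.

Theorem theorem3p2 (R : realType) (G : groupType)
    (G_countable : countable [set: G])
    (G_treeable : treeable_group R [set: G])
    (G_cost : (group_cost R [set: G] < +oo)%E)
    (w : G) (H : set G) (H_subgroup : subgroup H)
    (H_finite_index : finite_index H)
    (k : nat) (g : 'I_k -> G)
    (g_reps :
       double_coset_representatives (generated_subgroup [set w]) H g)
    (v : 'I_k -> G) (v_lift : complete_lift w H g v)
    (K_free : free_basis v (generated_subgroup (range v)))
    (K_factor : measure_free_factor R H (generated_subgroup (range v))) :
  measure_free_factor R [set: G] (generated_subgroup [set w]).
Proof.
have sgW : subgroup (generated_subgroup [set w]).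
  exact: generated_subgroup_subgroup.
have [_ _ _ [d [X [mu [a [E' [aH bE' HKE']]]]]]] := K_factor.
have g_inj i j : H ((g i)^-1 * g j)%g -> i = j.
  move=> Hij; apply/esym.
  apply: (double_coset_rep_inj sgW H_subgroup g_reps (u := 1%g) _ Hij).
    exact: subgroup1.
  by rewrite mul1g mulVKg.
have [n [r [b [rH rb]]]] :=
  left_transversal_extending H_subgroup H_finite_index g_inj.
split => //; first exact: subgroup_setT.
exists _, _, (copies_measure mu n), (induced_action H a r),
  (spread_relation (range b) E'); split.
- exact: (induced_free_pmp_action H_subgroup rH aH).
- by apply: (@spread_relation_borel R) => //; case: aH.
- exact: (induced_free_product G_countable H_subgroup g_reps v_lift K_free
            rH rb aH bE' HKE').
Qed.
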